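(* Let $f(x)=\mathbb{E}_P[F(x;S)]$ with $\mathcal{X}\subset\mathbb{R}^n$ closed and convex and $\mathcal{X}^\star=\operatorname{argmin}_{x\in\mathcal{X}}f(x)$, and assume the problem of minimizing $f$ over $\mathcal{X}$ is an interpolation problem: there is $x^\star\in\mathcal{X}^\star$ with $\inf_{x\in\mathcal{X}}F(x;s)=F(x^\star;s)$ for $P$-almost all $s$. Assume there exist constants $\lambda_0,\lambda_1>0$ and $\gamma\in[0,1]$ such that for all $\alpha\ge0$, $x\in\mathcal{X}$, $x^\star\in\mathcal{X}^\star$, $$\mathbb{E}\Big[(F(x;S)-F(x^\star;S))\min\Big\{\alpha,\frac{F(x;S)-F(x^\star;S)}{\|F'(x;S)\|_2^2}\Big\}\Big]\ge\min\{\lambda_0\alpha,\lambda_1\operatorname{dist}(x,\mathcal{X}^\star)^{1-\gamma}\}\operatorname{dist}(x,\mathcal{X}^\star)^{1+\gamma}.$$ Let $F_x(\cdot;s)$ be models satisfying conditions (C.i), (C.ii) and (C.iii) stated in the context, let $x_1\in\mathcal{X}$ be the (deterministic) initial point, let $S_1,S_2,\ldots$ be i.i.d. from $P$, and let $$x_{k+1}=\operatorname*{argmin}_{x\in\mathcal{X}}\Big\{F_{x_k}(x;S_k)+\frac{1}{2\alpha_k}\|x-x_k\|_2^2\Big\},\qquad k\ge1,$$ with stepsizes $\alpha_k=\alpha_0k^{-\beta}$ for some $\beta\in[0,1]$. Define $K_0=\Big\lfloor\Big(\frac{\lambda_0\alpha_0}{\lambda_1\operatorname{dist}(x_1,\mathcal{X}^\star)^{1-\gamma}}\Big)^{1/\beta}\Big\rfloor$.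 Then $$\mathbb{E}[\operatorname{dist}(x_{k+1},\mathcal{X}^\star)^2]\le\exp\Big(-\lambda_1\min\{k,K_0\}-\frac{\lambda_0}{\operatorname{dist}(x_1,\mathcal{X}^\star)^{1-\gamma}}\sum_{i=K_0+1}^k\alpha_i\Big)\operatorname{dist}(x_1,\mathcal{X}^\star)^2.$$
   Context: Problem: $P$ is a probability distribution on a sample space $\mathcal{S}$; for each $s\in\mathcal{S}$, $F(\cdot;s):\mathbb{R}^n\to\mathbb{R}\cup\{+\infty\}$ is closed convex and subdifferentiable on the closed convex set $\mathcal{X}$; $S\sim P$. $F'(x;s)$ denotes an arbitrary element of the subdifferential $\partial F(x;s)$. $\operatorname{dist}$ is Euclidean distance. $\alpha_0>0$ is the initial stepsize, and the sum is empty if $k\le K_0$. Models: for each $x\in\mathcal{X}$ and $s\in\mathcal{S}$ there is a function $F_x(\cdot;s)$ such that: (C.i) $y\mapsto F_x(y;s)$ is convex and subdifferentiable on $\mathcal{X}$; (C.ii) $F_x(y;s)\le F(y;s)$ for all $y\in\mathcal{X}$, and $F_x(x;s)=F(x;s)$; (C.iii) $F_x(y;s)\ge\inf_{z\in\mathcal{X}}F(z;s)$ for all $y\in\mathcal{X}$. It is understood (as a consequence of (C.ii)) that $\partial F_x(y;s)|_{y=x}\subset\partial F(x;s)$. *)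

(* Defs.v *)
From mathcomp Require Export all_boot all_order all_algebra.
From mathcomp Require Export all_classical all_reals all_analysis.
From mathcomp Require Export finmap measurable_realfun.

Set Implicit Arguments.
Unset Strict Implicit.
Unset Printing Implicit Defensive.

Export Order.TTheory GRing.Theory Num.Theory.
Export numFieldNormedType.Exports.

#[global] Open Scope classical_set_scope.
#[global] Open Scope ring_scope.

Section euclidean.
Context {R : realType} {n : nat}.
Implicit Types (x y : 'rV[R]_n) (A : set 'rV[R]_n).

(* The library norm of 'rV[R]_n is the sup norm: it is used here only through
   the topology, all distances below are Euclidean. *)
Definition dot x y : R := \sum_(i < n) x ord0 i * y ord0 i.

Definition norm2 x : R := Num.sqrt (dot x x).

Definition dist2 x A : R := inf [set norm2 (x - y) | y in A].

End euclidean.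

(* R^n with its Borel sigma-algebra. *)
Definition borel_rV (R : realType) (n : nat) :=
  g_sigma_algebraType (@open 'rV[R]_n).

Section convex_analysis.
Context {R : realType} {n : nat}.
Implicit Types (f : 'rV[R]_n -> \bar R) (X : set 'rV[R]_n).
Local Open Scope ereal_scope.

Definition econvex_on X f := forall x y (t : R), X x -> X y -> (0 < t < 1)%R ->
  f ((1 - t) *: x + t *: y)%R <= (1 - t)%:E * f x + t%:E * f y.

Definition closed_convex f :=
  [/\ forall x, -oo < f x, econvex_on setT f & lower_semicontinuous f].

(* As usual the subdifferential is empty outside the effective domain. *)
Definition subdifferential f x : set 'rV[R]_n :=
  [set g | f x \is a fin_num /\ forall y, f x + (dot g (y - x)%R)%:E <= f y].

Definition subdifferentiable_on X f :=
  forall x, X x -> subdifferential f x !=set0.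

Definition argmin X f : set 'rV[R]_n :=
  [set x | X x /\ forall y, X y -> f x <= f y].

End convex_analysis.

Section stochastic_optimization.
Context {d : measure_display} {T : measurableType d} {R : realType} {n : nat}.
Variables (P : probability T R) (X : set 'rV[R]_n).
(* F x s is F(x; s), and M x y s is F_x(y; s). *)
Variables (F : 'rV[R]_n -> T -> \bar R) (M : 'rV[R]_n -> 'rV[R]_n -> T -> \bar R).
Local Open Scope ereal_scope.

Definition objective (x : 'rV[R]_n) : \bar R := \int[P]_s F x s.

Definition solution_set : set 'rV[R]_n := argmin X objective.

(* The expectation f x is meaningful, in the sense of R \cup {+oo}, on X. *)
Definition objective_well_defined := forall x, X x ->
  measurable_fun setT (F x) /\ \int[P]_s (F x)^\- s < +oo.

Definition interpolation_problem := exists2 xs, solution_set xs &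
  {ae P, forall s, ereal_inf [set F z s | z in X] = F xs s}.

Definition cond_Ci := forall x s, X x ->
  econvex_on X (fun y => M x y s) /\ subdifferentiable_on X (fun y => M x y s).

Definition cond_Cii := forall x s, X x ->
  (forall y, X y -> M x y s <= F y s) /\ M x x s = F x s.

(* This inclusion, which the literature reads off from the previous condition,
   does not follow from it when x is a boundary point of X, because the
   domination M x y s <= F y s is only required for y in X. *)
Definition subgradient_inclusion := forall x s, X x ->
  subdifferential (fun y => M x y s) x `<=` subdifferential (F ^~ s) x.

Definition cond_Ciii := forall x y s, X x -> X y ->
  ereal_inf [set F z s | z in X] <= M x y s.

(* Measurable version of "F'(x; s) is an element of the subdifferential", so
   that F'(x; S) is a random vector. *)
Definition subgradient_selection (x : 'rV[R]_n) (G : T -> 'rV[R]_n) :=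
  measurable_fun setT (G : T -> borel_rV R n) /\
  forall s, subdifferential (F ^~ s) x (G s).

(* (F(x; s) - F(z; s)) min {a, (F(x; s) - F(z; s)) / |g|^2}; on X the values
   of F are finite, so that [fine] loses nothing. For g = 0 the quotient is 0
   by convention; then x minimizes F(.; s), and when z minimizes F(.; s) on X
   as well the first factor vanishes. *)
Definition growth (a : R) (x z g : 'rV[R]_n) (s : T) : R :=
  let D := (fine (F x s) - fine (F z s))%R in
  (D * Num.min a (D / norm2 g ^+ 2))%R.

Definition growth_condition (l0 l1 gam : R) :=
  forall (a : R) x xs G, (0 <= a)%R -> X x -> solution_set xs ->
  subgradient_selection x G ->
  let D := dist2 x solution_set in
  (Num.min (l0 * a) (l1 * D `^ (1 - gam)) * D `^ (1 + gam))%:E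
    <= 'E_P[fun s => growth a x xs (G s) s].

Definition prox_step (a : R) (x : 'rV[R]_n) (s : T) : set 'rV[R]_n :=
  argmin X (fun y => M x y s + ((2 * a)^-1 * norm2 (y - x) ^+ 2)%:E).

(* Measurability of the models, for a stepsize a: the update is jointly
   measurable in the current point and in the sample, so that the iterates are
   random vectors, and the subgradients of the models can be chosen measurably
   in the sample. *)
Definition measurable_prox (a : R) :=
  exists2 U : borel_rV R n * T -> borel_rV R n,
    measurable_fun ((X : set (borel_rV R n)) `*` [set: T]) U &
    forall x s, X x -> prox_step a x s (U (x, s)).

Definition measurable_model_subgradient := forall x, X x ->
  exists2 G : T -> borel_rV R n, measurable_fun setT G &
    forall s, subdifferential (fun y => M x y s) x (G s).

End stochastic_optimization.

(* Independent, identically distributed with law P, on the probability space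
   (Omega, Pr). *)
Definition iid_from {d d' : measure_display} {Omega : measurableType d'}
    {T : measurableType d} {R : realType} (Pr : probability Omega R)
    (P : probability T R) (S : nat -> Omega -> T) :=
  [/\ forall i, measurable_fun setT (S i),
      forall i (A : set T), measurable A -> Pr (S i @^-1` A) = P A
    & forall (J : {fset nat}) (A : nat -> set T),
        (forall j, measurable (A j)) ->
        Pr (\bigcap_(j in [set` J]) (S j @^-1` A j)) =
        (\prod_(j <- J) Pr (S j @^-1` A j))%E].

Section rate.
Context {R : realType}.

Definition stepsize (a0 beta : R) (k : nat) : R := a0 * k%:R `^ (- beta).

(* The integer floor (rho ^ (1 / beta)), where the case beta = 0 is the limit
   beta -> 0+ of rho ^ (1 / beta); hence a value in the extended reals. *)
Definition threshold (rho beta : R) : \bar R :=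
  if beta == 0 then
    (if rho < 1 then 0%:E else if rho == 1 then 1%:E else +oo%E)
  else ((Num.floor (rho `^ beta^-1))%:~R)%:E.

End rate.

(* Main.v *)
(* Write D(x) for the Euclidean distance to the solution set.  Under
   interpolation every solution minimizes F(.; s) for almost all s (unless the
   objective is +oo on X, when every point is a solution).  The optimality
   condition of the proximal step, together with the bounds
   inf F <= F_x(x_{k+1}) and F_x(x) + <g, x_{k+1} - x> <= F_x(x_{k+1}), gives

     |x_{k+1} - z|^2 <= |x_k - z|^2
                        - (F(x_k) - F(z)) min {alpha_k, (F(x_k) - F(z)) / |g|^2}

   for every solution z.  Hence D(x_k) is almost surely nonincreasing, and
   since x_k is independent of S_k, integrating and using the growth condition
   yields E D(x_{k+1})^2 <= (1 - c_k) E D(x_k)^2 with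
   c_k = min {l1, l0 alpha_k / D(x_1)^(1 - gam)}.  Finally 1 - c <= exp (- c),
   and K_0 is the last index at which c_k = l1. *)

Require Import Defs.
From mathcomp Require Import ring lra.

Set Implicit Arguments.
Unset Strict Implicit.
Unset Printing Implicit Defensive.

(** * Euclidean distance *)

Section Euclid.
Context {R : realType} {n : nat}.
Implicit Types (x y z u v : 'rV[R]_n) (A : set 'rV[R]_n).

Lemma dotC x y : dot x y = dot y x.
Proof. by apply: eq_bigr => i _; rewrite mulrC. Qed.

Lemma dotDl x y z : dot (x + y) z = dot x z + dot y z.
Proof. by rewrite -big_split; apply: eq_bigr => i _; rewrite /= mxE mulrDl. Qed.

Lemma dotZl a x y : dot (a *: x) y = a * dot x y.
Proof. by rewrite mulr_sumr; apply: eq_bigr => i _; rewrite mxE mulrA. Qed.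

Lemma dotNl x y : dot (- x) y = - dot x y.
Proof. by rewrite -scaleN1r dotZl mulN1r. Qed.

Lemma dotDr x y z : dot z (x + y) = dot z x + dot z y.
Proof. by rewrite dotC dotDl !(dotC z). Qed.

Lemma dotZr a x y : dot y (a *: x) = a * dot y x.
Proof. by rewrite dotC dotZl dotC. Qed.

Lemma dotNr x y : dot y (- x) = - dot y x.
Proof. by rewrite dotC dotNl dotC. Qed.

Definition dotE := (dotDl, dotDr, dotNl, dotNr, dotZl, dotZr).

Lemma dot_ge0 x : 0 <= dot x x.
Proof. by apply: sumr_ge0 => i _; rewrite -expr2 sqr_ge0. Qed.

Lemma dot_eq0 x : dot x x <= 0 -> x = 0.
Proof.
move=> x0; have /eqP : dot x x = 0 by apply/eqP; rewrite eq_le x0 dot_ge0.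
rewrite psumr_eq0 => [/allP h|i _]; last by rewrite -expr2 sqr_ge0.
apply/rowP => i; rewrite mxE; apply/eqP.
by have := h i (mem_index_enum i); rewrite mulf_eq0 orbb.
Qed.

Lemma norm2_ge0 x : 0 <= norm2 x. Proof. exact: sqrtr_ge0. Qed.

Lemma sqr_norm2 x : norm2 x ^+ 2 = dot x x.
Proof. by rewrite sqr_sqrtr// dot_ge0. Qed.

Lemma sqr_norm2D x y :
  norm2 (x + y) ^+ 2 = norm2 x ^+ 2 + 2 * dot x y + norm2 y ^+ 2.
Proof. rewrite !sqr_norm2 !dotE (dotC y x); ring. Qed.

Lemma dist2_ge0 x A : 0 <= dist2 x A.
Proof.
have [->|/set0P A0] := eqVneq A set0; first by rewrite /dist2 image_set0 inf0.
apply: lb_le_inf; first by case: A0 => a Aa; exists (norm2 (x - a)), a.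
by move=> _ [y _ <-]; exact: norm2_ge0.
Qed.

Lemma dist2_le x A y : A y -> dist2 x A <= norm2 (x - y).
Proof.
move=> Ay; apply: ge_inf; last by exists y.
by exists 0 => _ [z _ <-]; exact: norm2_ge0.
Qed.

Lemma dist2_mem x A : A x -> dist2 x A = 0.
Proof.
move=> Ax; apply/eqP; rewrite eq_le dist2_ge0 andbT.
rewrite (le_trans (dist2_le x Ax))//.
by rewrite subrr /norm2 /dot big1 ?sqrtr0// => i _; rewrite mxE mul0r.
Qed.

Lemma le_dist2 x A r : A !=set0 -> (forall y, A y -> r <= norm2 (x - y)) ->
  r <= dist2 x A.
Proof.
move=> [a Aa] h; apply: lb_le_inf; first by exists (norm2 (x - a)), a.
by move=> _ [y Ay <-]; exact: h.
Qed.

Lemma dist2_lt x A r : A !=set0 -> dist2 x A < r ->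
  exists2 y, A y & norm2 (x - y) < r.
Proof.
move=> [a Aa] /inf_lt[|_ [y Ay <-] ?]; last by exists y.
by exists (norm2 (x - a)), a.
Qed.

Lemma sqr_dist2_le x A y : A y -> dist2 x A ^+ 2 <= norm2 (x - y) ^+ 2.
Proof.
by move=> Ay; rewrite ler_pXn2r ?nnegrE ?dist2_ge0 ?norm2_ge0 ?dist2_le.
Qed.

(** Passes from a bound valid at every solution to the squared distance without a nearest point of
    [A] having to exist. *)
Lemma le_sqr_dist2 x A r : A !=set0 ->
  (forall y, A y -> r <= norm2 (x - y) ^+ 2) -> r <= dist2 x A ^+ 2.
Proof.
move=> A0 h; have [r0|/ltW r0] := leP 0 r; last exact: le_trans r0 (sqr_ge0 _).
rewrite -(sqr_sqrtr r0) ler_pXn2r ?nnegrE ?dist2_ge0 ?sqrtr_ge0//.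
apply: le_dist2 => // y Ay.
by rewrite -(ger0_norm (norm2_ge0 _)) -sqrtr_sqr ler_wsqrtr ?h.
Qed.

End Euclid.

(** * Deterministic proximal steps *)

Section Prox.
Context {R : realType} {n : nat}.
Implicit Types (x y z u v g : 'rV[R]_n) (X : set 'rV[R]_n) (f : 'rV[R]_n -> \bar R).

(** For a frozen sample: [prox_step X M a x s] is this set for the model [f := fun y => M x y s], by
    conversion. *)
Definition prox X f (a : R) x : set 'rV[R]_n :=
  argmin X (fun y => f y + ((2 * a)^-1 * norm2 (y - x) ^+ 2)%:E)%E.

Lemma subdifferentiable_fin X f x :
  subdifferentiable_on X f -> X x -> f x \is a fin_num.
Proof. by move=> h /h[g []]. Qed.

Lemma convex_setP X y z (t : R) : convex_set X -> X y -> X z -> 0 < t < 1 ->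
  X ((1 - t) *: y + t *: z).
Proof.
move=> Xcv Xy Xz /andP[t0 t1].
have h : Itv.spec (@Itv.num_sem R) (Itv.Real `[0%Z, 1%Z]) t.
  by apply/and3P; rewrite num_real/= !bnd_simp/= (ltW t0) (ltW t1).
(* Abstract convex combinations put the weight [t] on their first point, hence [z] before [y]. *)
have := Xcv z y (Itv.mk h) (mem_set Xz) (mem_set Xy).
by move=> /set_mem; rewrite addrC.
Qed.

(** Replaces the limit as t tends to 0 in the next lemma. *)
Lemma le_of_le_small (r c : R) : (forall t, 0 < t < 1 -> r <= t * c) -> r <= 0.
Proof.
move=> h; rewrite leNgt; apply/negP => r0.
have c0 : 0 < c.
  have /h : 0 < (2^-1 : R) < 1 by apply/andP; split; lra.
  by lra.
(* Here t < 1 and t c = (r / 2) (c / (r + c)) < r, against the hypothesis. *)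
pose t := r / (2 * (r + c)).
have rc : 0 < r + c by lra.
have tE : t * (2 * (r + c)) = r by rewrite /t mulfVK// mulf_neq0// lt0r_neq0.
have t0 : 0 < t by rewrite /t divr_gt0// mulr_gt0//.
have t1 : t < 1 by rewrite /t ltr_pdivrMr; [lra|exact: mulr_gt0].
have /h : 0 < t < 1 by rewrite t0.
nra.
Qed.

(** The optimality condition in subgradient-free form: compare the minimizer [u] with the point
    [(1 - t) *: u + t *: z], use convexity of [f], divide by [t] and let [t] tend to 0. *)
Lemma prox_three_point X f a x u z : 0 < a -> convex_set X -> econvex_on X f ->
  subdifferentiable_on X f -> prox X f a x u -> X z ->
  norm2 (u - z) ^+ 2 + norm2 (u - x) ^+ 2 + 2 * a * (fine (f u) - fine (f z))
    <= norm2 (x - z) ^+ 2.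
Proof.
move=> a0 Xcv fcv fsub [Xu hu] Xz.
have fu := subdifferentiable_fin fsub Xu.
have fz := subdifferentiable_fin fsub Xz.
rewrite -subr_le0; apply: (@le_of_le_small _ (norm2 (z - u) ^+ 2)) => t /andP[t0 t1].
pose y := (1 - t) *: u + t *: z.
have Xy : X y by apply: convex_setP; rewrite ?t0.
have fy := subdifferentiable_fin fsub Xy.
have := fcv u z t Xu Xz; rewrite t0 t1 => /(_ isT) h2.
have h1 := hu y Xy; rewrite -/y in h2.
case: (f u) (f z) (f y) fu fz fy h1 h2 => [p||]// [q||]// [r||]// _ _ _.
rewrite -!EFinM -!EFinD !lee_fin /= => h1 h2.
have h3 : 2 * a * p + norm2 (u - x) ^+ 2 <=
    2 * a * ((1 - t) * p + t * q) + norm2 (y - x) ^+ 2.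
  have : p + (2 * a)^-1 * norm2 (u - x) ^+ 2 <=
    ((1 - t) * p + t * q) + (2 * a)^-1 * norm2 (y - x) ^+ 2 by lra.
  have a2 : 0 < 2 * a by lra.
  rewrite -(ler_pM2l a2) !mulrDr !mulrA mulfV ?lt0r_neq0// !mul1r.
  by lra.
have h4 : t * (2 * a * (p - q)) <= norm2 (y - x) ^+ 2 - norm2 (u - x) ^+ 2 by nra.
(* The exact expansion in [t]; its second-order term is the one that vanishes in the limit. *)
have h5 : norm2 (y - x) ^+ 2 - norm2 (u - x) ^+ 2 =
   t * (norm2 (x - z) ^+ 2 - norm2 (u - z) ^+ 2 - norm2 (u - x) ^+ 2 +
     t * norm2 (z - u) ^+ 2).
  rewrite !sqr_norm2 /y !dotE (dotC u z) (dotC x z) (dotC u x); ring.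
by move: h4; rewrite h5 ler_pM2l// => h4; lra.
Qed.

(** In the sum of the three-point inequalities for [u] against [v] and for [v] against [u],
    everything cancels except 2 |u - v|^2 <= 0. *)
Lemma prox_unique X f a x u v : 0 < a -> convex_set X -> econvex_on X f ->
  subdifferentiable_on X f -> prox X f a x u -> prox X f a x v -> u = v.
Proof.
move=> a0 Xcv fcv fsub pu pv; have [Xu hu] := pu; have [Xv hv] := pv.
have fu := subdifferentiable_fin fsub Xu.
have fv := subdifferentiable_fin fsub Xv.
have := prox_three_point a0 Xcv fcv fsub pu Xv.
have := prox_three_point a0 Xcv fcv fsub pv Xu.
move=> h1 h2; apply/eqP; rewrite -subr_eq0; apply/eqP/dot_eq0.
move: h1 h2; rewrite !sqr_norm2 !dotE (dotC x u) (dotC x v) (dotC u v); lra.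
Qed.

(* With [tau = min a (D / |g|^2)], the quantity [|u - x|^2 + 2 tau <g, u - x>]
   is bounded below by completing the square. *)
Lemma prox_decrease X f a x u z g m : 0 < a -> convex_set X ->
  econvex_on X f -> subdifferentiable_on X f -> prox X f a x u ->
  X x -> X z -> subdifferential f x g -> (f z <= m%:E)%E -> (m%:E <= f u)%E ->
  let D := fine (f x) - m in 0 <= D ->
  norm2 (u - z) ^+ 2 + D * Num.min a (D / norm2 g ^+ 2) <= norm2 (x - z) ^+ 2.
Proof.
move=> a0 Xcv fcv fsub pu Xx Xz [fx gx] zm mu D D0.
have [Xu hu] := pu.
have fu := subdifferentiable_fin fsub Xu.
have fz := subdifferentiable_fin fsub Xz.
have := prox_three_point a0 Xcv fcv fsub pu Xz.
move: (gx u) zm mu D0; rewrite /D.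
case: (f u) (f x) (f z) fu fx fz => [p||]// [q||]// [r||]// _ _ _.
rewrite -EFinD !lee_fin /= => h1 zm mu D0 h2.
set tau := Num.min _ _.
have t0 : 0 <= tau by rewrite /tau le_min (ltW a0) divr_ge0// sqr_ge0.
have ta : tau <= a by rewrite /tau ge_min lexx.
have tD : tau * norm2 g ^+ 2 <= q - m.
  have [->|g0] := eqVneq (norm2 g ^+ 2) 0; first by rewrite mulr0.
  rewrite -ler_pdivlMr; first by rewrite /tau ge_min lexx orbT.
  by rewrite lt0r g0 sqr_ge0.
have := sqr_ge0 (norm2 (u - x + tau *: g)).
rewrite (sqr_norm2D (u - x)) (sqr_norm2 (tau *: g)) dotZl !dotZr -sqr_norm2.
rewrite (dotC _ g) => h3.
have h4 : tau * (tau * norm2 g ^+ 2) <= tau * (q - m) by exact: ler_wpM2l.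
(* [p], [q], [r] are the values of [f] at [u], [x], [z]. Since r <= m <= p, the stepsize may be
   lowered to [tau]. The term 2 tau (q - m) from [h6] loses one half to [h4], and the other half is
   the claimed decrease. *)
have h5 : tau * (p - m) <= a * (p - r) by apply: ler_pM => //; lra.
have h6 : tau * (q - m + dot g (u - x)) <= tau * (p - m) by apply: ler_wpM2l => //; lra.
lra.
Qed.

End Prox.

(** * Borel measurability *)

Section Borel.
Context {R : realType} {n : nat}.
Implicit Types (x y z : 'rV[R]_n) (A : set 'rV[R]_n).

Lemma open_measurable_rV A : open A -> measurable (A : set (borel_rV R n)).
Proof. by move=> oA; apply: sub_sigma_algebra. Qed.

Lemma closed_measurable_rV A : closed A -> measurable (A : set (borel_rV R n)).
Proof.
move=> cA; rewrite -(setCK A); apply: measurableC.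
by apply: open_measurable_rV; exact: closed_openC.
Qed.

(** Stated for upper semicontinuous functions, since the distance to a set is an infimum of
    continuous functions. *)
Lemma open_lt_measurable_fun (f : 'rV[R]_n -> R) :
  (forall r, open [set y | f y < r]) ->
  measurable_fun setT (f : borel_rV R n -> R).
Proof.
move=> of_; apply: (measurability _ (RGenInftyO.measurableE R)).
move=> _ [_ [r ->] <-]; rewrite setTI; apply: open_measurable_rV.
exact: of_.
Qed.

Lemma norm2_continuous z : continuous (fun y : 'rV[R]_n => norm2 (y - z)).
Proof.
have coordB i : continuous (fun w : 'rV[R]_n => (w - z) ord0 i).
  have -> : (fun w : 'rV[R]_n => (w - z) ord0 i) = (fun w => w ord0 i - z ord0 i).
    by apply/funext => w; rewrite !mxE.
  by move=> w; apply: continuousB; [exact: coord_continuous|exact: cst_continuous].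
move=> y; apply: (@continuous_comp _ _ _ (fun y => dot (y - z) (y - z)) Num.sqrt).
  2: by exact: sqrt_continuous.
apply: continuous_big; first exact: add_continuous.
by move=> i _ w; apply: continuousM; exact: coordB.
Qed.

Lemma open_norm2_lt z (r : R) : open [set y | norm2 (y - z) < r].
Proof.
apply: (@open_comp _ _ (fun y : 'rV[R]_n => norm2 (y - z)) [set t | t < r]).
  by move=> y _; exact: norm2_continuous.
exact: open_lt.
Qed.

Lemma measurable_norm2 : measurable_fun setT (@norm2 R n : borel_rV R n -> R).
Proof.
apply: open_lt_measurable_fun => r; have := @open_norm2_lt 0 r.
by under eq_set do rewrite subr0.
Qed.

Lemma measurable_dist2 A : A !=set0 ->
  measurable_fun setT ((fun y => dist2 y A) : borel_rV R n -> R).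
Proof.
move=> A0; apply: open_lt_measurable_fun => r.
rewrite [X in open X](_ : _ = \bigcup_(z in A) [set y | norm2 (y - z) < r]).
  by apply: bigcup_open => z _; exact: open_norm2_lt.
apply/seteqP; split => [y /= /(dist2_lt A0)[z Az ?]|y [z Az /= h]].
  by exists z.
exact: le_lt_trans (dist2_le _ Az) h.
Qed.

End Borel.

(** On nonnegative reals the inverse is the power -1, also at 0, where both are 0 by convention. *)
Lemma measurable_fun_invr_ge0 d (T : measurableType d) (R : realType) (f : T -> R) :
  (forall t, 0 <= f t) -> measurable_fun setT f ->
  measurable_fun setT (fun t => (f t)^-1).
Proof.
move=> f0 mf; under eq_fun do rewrite -(powR_inv1 (f0 _)).
exact: (measurableT_comp (measurable_powR _)).
Qed.

(** * Independence of the iterates and the samples *)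

Section Independence.
Context {d1 d2 d3 : measure_display} {Omega : measurableType d1}
  {V : measurableType d2} {T : measurableType d3} {R : realType}
  (Pr : probability Omega R) (P : probability T R).
Local Open Scope ereal_scope.

Lemma product_mscaler (m : {sigma_finite_measure set V -> \bar R}) (p : {nonneg R})
  (C : set (V * T)) : measurable C ->
  (m \x mscale p P) C = p%:num%:E * (m \x P) C.
Proof.
move=> mC; rewrite /= /product_measure1 -ge0_integralZl//.
exact: measurable_fun_xsection.
Qed.

(** Both sides are measures in [C] that agree on rectangles, so uniqueness of the product measure
    applies. The event [W] will be one about later samples. *)
Lemma joint_lawI (Y : Omega -> V) (Z : Omega -> T) (mY : measurable_fun setT Y)
    (W : set Omega) :
  measurable_fun setT Z -> measurable W ->
  (forall B A, measurable B -> measurable A ->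
    Pr (Y @^-1` B `&` Z @^-1` A `&` W) = Pr (Y @^-1` B) * (P A * Pr W)) ->
  forall C, measurable C ->
    Pr ((fun w => (Y w, Z w)) @^-1` C `&` W) =
    Pr W * (distribution Pr (mfun_Sub (mem_set mY)) \x P) C.
Proof.
move=> mZ mW h C mC.
(* The factor [Pr W] is absorbed into the second measure, which makes the right-hand side a genuine
   product measure. *)
pose p := NngNum (fine_ge0 (measure_ge0 Pr W)).
have pE : p%:num%:E = Pr W by rewrite /= fineK// fin_num_measure.
have mYZ : measurable_fun setT (fun w => (Y w, Z w)) by exact: measurable_fun_pair.
pose YZ : {mfun Omega >-> (V * T)%type} := mfun_Sub (mem_set mYZ).
rewrite -pE -product_mscaler//.
symmetry; apply: (@product_measure_unique _ _ _ _ _ _ (mscale p P)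
  (pushforward (mrestr Pr mW) YZ)) => // B A mB mA.
rewrite [RHS](_ : _ = Pr (Y @^-1` B) * (Pr W * P A)).
  by rewrite [LHS](h B A mB mA) (muleC (P A)).
by rewrite -pE.
Qed.

Lemma joint_law (Y : Omega -> V) (Z : Omega -> T) (mY : measurable_fun setT Y) :
  measurable_fun setT Z ->
  (forall B A, measurable B -> measurable A ->
    Pr (Y @^-1` B `&` Z @^-1` A) = Pr (Y @^-1` B) * P A) ->
  forall C, measurable C ->
    Pr ((fun w => (Y w, Z w)) @^-1` C) =
    (distribution Pr (mfun_Sub (mem_set mY)) \x P) C.
Proof.
move=> mZ h C mC; have := @joint_lawI Y Z mY setT mZ measurableT.
rewrite probability_setT => h1.
rewrite -[RHS]mul1e -h1// ?setIT// => B A mB mA.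
by rewrite mule1 setIT h.
Qed.

End Independence.

Section Future.
Context {d1 d2 d3 : measure_display} {Omega : measurableType d1}
  {V : measurableType d2} {T : measurableType d3} {R : realType}
  (Pr : probability Omega R) (P : probability T R) (S : nat -> Omega -> T).
Hypothesis hS : iid_from Pr P S.
Local Open Scope ereal_scope.

(** The sets [A] are indexed relative to [k], so that prepending a condition on [S k] is a shift of
    [A]. *)
Definition future k l (A : nat -> set T) : set Omega :=
  \bigcap_(j in `I_l) S (k + j)%N @^-1` A j.

Lemma measurable_sample k : measurable_fun setT (S k).
Proof. by case: hS. Qed.

Lemma measurable_future k l A : (forall j, measurable (A j)) ->
  measurable (future k l A).
Proof.
move=> mA; apply: bigcap_measurableType => j _.
by rewrite -[X in measurable X]setTI; apply: measurable_sample.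
Qed.

Lemma future_cons k l A B :
  S k @^-1` A `&` future k.+1 l B =
  future k l.+1 (fun j => if j is j'.+1 then B j' else A).
Proof.
apply/seteqP; split => w /=.
  by move=> [wA wB] [|j] /= jl; rewrite ?addn0// addnS -addSn; exact: wB.
move=> h; split; first by have := h 0%N isT; rewrite addn0.
by move=> j /= jl; have := h j.+1 jl; rewrite addnS -addSn.
Qed.

Lemma future_prob k l A : (forall j, measurable (A j)) ->
  Pr (future k l A) = \prod_(j < l) P (A j).
Proof.
move=> mA; have [_ hP hJ] := hS.
pose J : {fset nat} := seq_fset tt (iota k l).
rewrite (_ : future k l A =
  \bigcap_(i in [set` J]) S i @^-1` A (i - k)%N); last first.
  apply/seteqP; split => w h i /=.
    rewrite seq_fsetE mem_iota => /andP[ki il].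
    have /h : `I_l (i - k)%N by rewrite /= ltn_subLR.
    by rewrite /= subnKC.
  move=> il; have /h : [set` J] (k + i)%N.
    by rewrite /= seq_fsetE mem_iota leq_addr ltn_add2l.
  by rewrite /= addKn.
rewrite (hJ _ (fun i => A (i - k)%N))//.
rewrite (perm_big (iota k l)); last first.
  by apply: uniq_perm; rewrite ?fset_uniq ?iota_uniq// => i; rewrite seq_fsetE.
rewrite -[in iota k l](addn0 k) iotaDl big_map.
rewrite (_ : iota 0 l = index_iota 0 l) ?big_mkord; last by rewrite /index_iota subn0.
by apply: eq_bigr => i _; rewrite addKn hP.
Qed.

(* Independence of the whole future, not only of the next sample, is what
   propagates along the recursion. *)
Definition indep_of_future k (Y : Omega -> V) := forall B l A, measurable B ->
  (forall j, measurable (A j)) ->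
  Pr (Y @^-1` B `&` future k l A) = Pr (Y @^-1` B) * Pr (future k l A).

Lemma indep_of_future_sample k Y B A : indep_of_future k Y -> measurable B ->
  measurable A -> Pr (Y @^-1` B `&` S k @^-1` A) = Pr (Y @^-1` B) * P A.
Proof.
move=> iY mB mA; have := iY B 1%N (fun=> A) mB (fun=> mA).
rewrite future_prob// big_ord1 => <-; congr (Pr (_ `&` _)).
rewrite /future; apply/seteqP; split => w /=.
  by move=> h [|]//= _; rewrite addn0.
by move=> /(_ 0%N isT); rewrite addn0.
Qed.

End Future.

Section IndepStep.
Context {d1 d2 d3 d4 : measure_display} {Omega : measurableType d1}
  {V : measurableType d2} {V' : measurableType d4}
  {T : measurableType d3} {R : realType}
  (Pr : probability Omega R) (P : probability T R) (S : nat -> Omega -> T).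
Hypothesis hS : iid_from Pr P S.
Local Open Scope ereal_scope.

Lemma indep_of_future_cst k (v : V) : indep_of_future Pr S k (cst v).
Proof.
move=> B l A mB mA; have [vB|vB] := pselect (B v).
  rewrite (_ : cst v @^-1` B = setT) ?setTI ?probability_setT ?mul1e//.
  by apply/seteqP; split.
rewrite (_ : cst v @^-1` B = set0) ?set0I ?measure0 ?mul0e//.
by apply/seteqP; split.
Qed.

(** A condition on [S k] together with a future event from [k.+1] is a future event from [k], of
    which [Y] is independent. So the pair (Y, S k) has a product law even when restricted to the
    later event, and any function of it is independent of that event. *)
Lemma indep_of_future_step k (Y : Omega -> V) (h : V * T -> V') :
  measurable_fun setT Y -> measurable_fun setT h ->
  indep_of_future Pr S k Y ->
  indep_of_future Pr S k.+1 (fun w => h (Y w, S k w)).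
Proof.
move=> mY mh iY B l A mB mA.
have mS := measurable_sample hS k.
have mW := measurable_future hS k.+1 l mA.
have mC : measurable (h @^-1` B) by rewrite -[X in measurable X]setTI; exact: mh.
rewrite [LHS](joint_lawI (P := P) mY mS mW _ mC); last first.
  move=> B' A' mB' mA'; rewrite -setIA future_cons.
  have mA'' j : measurable (if j is j'.+1 then A j' else A') by case: j.
  by rewrite iY// (future_prob hS)//= big_ord_recl/= (future_prob hS)//.
rewrite muleC; congr (_ * _).
symmetry; apply: (joint_law (P := P) mY mS _ mC) => *.
exact: (indep_of_future_sample hS).
Qed.

End IndepStep.

(** * Interpolation and one stochastic step *)

Section Integration.
Context {d : measure_display} {T : measurableType d} {R : realType}
  (mu : {measure set T -> \bar R}).
Local Open Scope ereal_scope.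

Lemma integrable_of_integral_lty (f : T -> \bar R) : measurable_fun setT f ->
  \int[mu]_t f^\- t < +oo -> \int[mu]_t f t < +oo -> mu.-integrable setT f.
Proof.
move=> mf fneg flt; apply/integrableP; split => //.
have fposlt : \int[mu]_t f^\+ t < +oo.
  have [a aE] : exists a, \int[mu]_t f^\- t = a%:E.
    exists (fine (\int[mu]_t f^\- t)); rewrite fineK// ge0_fin_numE//.
    exact: integral_ge0.
  by move: flt; rewrite integralE aE lteBlDr.
rewrite (_ : (fun t => `|f t|) = f^\+ \+ f^\-); last by rewrite -fune_abse.
rewrite ge0_integralD//; [exact: lte_add_pinfty|..].
  exact: measurable_funepos.
exact: measurable_funeneg.
Qed.

(** The difference [g t - f t] is almost everywhere nonnegative with integral at most 0. *)
Lemma ae_eq_of_ae_le (f g : T -> \bar R) : mu.-integrable setT f ->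
  mu.-integrable setT g -> (forall t, f t \is a fin_num) ->
  {ae mu, forall t, f t <= g t} -> \int[mu]_t g t <= \int[mu]_t f t ->
  {ae mu, forall t, f t = g t}.
Proof.
move=> fi gi ff fg gf.
have igf : mu.-integrable setT (fun t => g t - f t) by exact: integrableB.
have mgf := measurable_int _ igf.
have : \int[mu]_t `|g t - f t| = 0.
  apply/eqP; rewrite eq_le integral_ge0// andbT.
  rewrite (@ae_eq_integral _ _ _ mu setT (fun t => g t - f t))//.
  - rewrite integralB// leeBlDr ?add0e//.
    exact: integrable_fin_num.
  - exact: measurableT_comp.
  - by apply: filterS fg => t fgt _; rewrite gee0_abs// sube_ge0// ff.
move=> /(ae_eq_integral_abs mu measurableT mgf); apply: filterS => t /(_ I).
move: (ff t); case: (f t) => // r _; case: (g t) => //= q.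
by rewrite -EFinB => -[] /eqP; rewrite subr_eq0 => /eqP ->.
Qed.

End Integration.

Section Interpolation.
Context {d : measure_display} {T : measurableType d} {R : realType} {n : nat}
  (P : probability T R) (X : set 'rV[R]_n) (F : 'rV[R]_n -> T -> \bar R).
Hypothesis hFsub : forall s, subdifferentiable_on X (fun x => F x s).
Hypothesis hf : objective_well_defined P X F.
Hypothesis hinterp : interpolation_problem P X F.
Local Open Scope ereal_scope.

Definition ae_minimizer z := {ae P, forall s, ereal_inf [set F y s | y in X] = F z s}.

(* The first case is that of an objective equal to +oo on X. *)
Lemma solution_set_alt :
  (X `<=` solution_set P X F) \/ (forall z, solution_set P X F z -> ae_minimizer z).
Proof.
have [xs [Xxs xsmin] hxs] := hinterp.
have [flt|] := ltP (objective P F xs) +oo; last first.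
  rewrite leye_eq => /eqP fy; left => x Xx; split => // y Xy.
  by have := xsmin _ Xy; rewrite fy leye_eq => /eqP ->; rewrite leey.
right => z [Xz zmin].
have zxs := zmin _ Xxs.
have [mxs nxs] := hf Xxs; have [mz nz] := hf Xz.
have ixs := integrable_of_integral_lty mxs nxs flt.
have iz := integrable_of_integral_lty mz nz (le_lt_trans zxs flt).
(* [xs] minimizes almost every [F ^~ s] while the integral for [z] is no larger, so the two values
   agree almost everywhere and [z] inherits the minimality. *)
have le_xs : {ae P, forall s, F xs s <= F z s}.
  by apply: filterS hxs => s <-; apply: ereal_inf_lbound; exists z.
have := ae_eq_of_ae_le ixs iz (fun s => subdifferentiable_fin (hFsub s) Xxs) le_xs zxs.
by apply: filterS2 hxs => s -> ->.
Qed.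

End Interpolation.

Section OneStep.
Context {d : measure_display} {T : measurableType d} {R : realType} {n : nat}
  (P : probability T R) (X : set 'rV[R]_n) (F : 'rV[R]_n -> T -> \bar R)
  (M : 'rV[R]_n -> 'rV[R]_n -> T -> \bar R).
Hypothesis hXcv : convex_set X.
Hypothesis hFsub : forall s, subdifferentiable_on X (fun x => F x s).
Hypothesis hf : objective_well_defined P X F.
Hypothesis hCi : cond_Ci X M.
Hypothesis hCii : cond_Cii X F M.
Hypothesis hCiii : cond_Ciii X F M.

Lemma prox_step_decrease a x s u z g : 0 < a -> X x -> X z ->
  prox_step X M a x s u -> subdifferential (fun y => M x y s) x g ->
  ereal_inf [set F y s | y in X] = F z s ->
  0 <= growth F a x z g s /\
  norm2 (u - z) ^+ 2 + growth F a x z g s <= norm2 (x - z) ^+ 2.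
Proof.
move=> a0 Xx Xz pu gx zmin.
have [Mcv Msub] := hCi s Xx.
have [MF MxE] := hCii s Xx.
have Fz := subdifferentiable_fin (hFsub s) Xz.
have Fx := subdifferentiable_fin (hFsub s) Xx.
have D0 : 0 <= fine (F x s) - fine (F z s).
  rewrite subr_ge0 fine_le// -zmin.
  by apply: ereal_inf_lbound; exists x.
split.
  by rewrite mulr_ge0// le_min (ltW a0) divr_ge0// sqr_ge0.
(* The level [m] is the value of F at [z]: (C.ii) puts the model at [z] below it, and (C.iii) puts
   the model at [u] above it, because this value is the infimum. *)
rewrite /growth -MxE; apply: (prox_decrease a0 hXcv Mcv Msub pu Xx Xz gx).
- by rewrite fineK// MF.
- by rewrite fineK// -zmin hCiii//; case: pu.
- by rewrite MxE.
Qed.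

Lemma measurable_growth a x z (G : T -> borel_rV R n) : X x -> X z ->
  measurable_fun setT G -> measurable_fun setT (fun s => growth F a x z (G s) s).
Proof.
move=> Xx Xz mG.
have mD : measurable_fun setT (fun s => fine (F x s) - fine (F z s)).
  apply: measurable_funB.
    by apply: (measurableT_comp (fine_measurable measurableT)); case: (hf Xx).
  by apply: (measurableT_comp (fine_measurable measurableT)); case: (hf Xz).
apply: measurable_funM => //; apply: measurable_minr; first exact: measurable_cst.
apply: measurable_funM => //; apply: measurable_fun_invr_ge0 => [s|].
  exact: sqr_ge0.
apply: measurable_funX; apply: measurableT_comp => //; exact: measurable_norm2.
Qed.

Hypothesis hincl : subgradient_inclusion X F M.
Hypothesis hMsub : measurable_model_subgradient X M.
Let Xstar := solution_set P X F.
Hypothesis Xstar0 : Xstar !=set0.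
Hypothesis Xstar_min : forall z, Xstar z -> ae_minimizer P X F z.

(** The exceptional null set of the decrease depends on the solution [z]; a minimizing sequence of
    solutions keeps the union of these null sets countable. *)
Lemma prox_step_dist2_le a x (u : T -> 'rV[R]_n) : 0 < a -> X x ->
  (forall s, prox_step X M a x s (u s)) ->
  {ae P, forall s, dist2 (u s) Xstar <= dist2 x Xstar}.
Proof.
move=> a0 Xx pu; have [G mG hG] := hMsub Xx.
have /choice[z hz] : forall k : nat, exists z, Xstar z /\
    norm2 (x - z) < dist2 x Xstar + k.+1%:R^-1.
  move=> k; have [|z ? ?] := @dist2_lt _ _ x Xstar (dist2 x Xstar + k.+1%:R^-1) Xstar0.
    by rewrite ltrDl invr_gt0.
  by exists z.
have : {ae P, forall s, forall k, ereal_inf [set F y s | y in X] = F (z k) s}.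
  by apply: ae_foralln => k; apply: Xstar_min; case: (hz k).
apply: filterS => s hs; apply/ler_addgt0Pl => e e0.
have [k ke] : exists k : nat, k.+1%:R^-1 < e.
  have /ltr_add_invr[k] := e0; rewrite add0r; by exists k.
have [zk xzk] := hz k.
have [Xz _] := zk.
have [g0 hle] := prox_step_decrease a0 Xx Xz (pu s) (hG s) (hs k).
apply: (le_trans (dist2_le _ zk)).
apply: (@le_trans _ _ (norm2 (x - z k))); last first.
  by rewrite (le_trans (ltW xzk))// addrC lerD2r ltW.
rewrite -(@ler_pXn2r _ 2)// ?nnegrE ?norm2_ge0//; lra.
Qed.

(** The decrease is integrated for each solution [z] separately, and the infimum over [z] is taken
    only afterwards, so each [z] may keep its own null set. *)
Lemma prox_step_integral a x (u : T -> borel_rV R n) (L : R) : 0 < a -> X x ->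
  measurable_fun setT u -> (forall s, prox_step X M a x s (u s)) ->
  (forall xs G, Xstar xs -> subgradient_selection F x G ->
    (L%:E <= 'E_P[fun s => growth F a x xs (G s) s])%E) ->
  (\int[P]_s (dist2 (u s) Xstar ^+ 2)%:E + L%:E <= (dist2 x Xstar ^+ 2)%:E)%E.
Proof.
move=> a0 Xx mu_ pu hL; have [G mG hG] := hMsub Xx.
have mdist : measurable_fun setT (fun s => (dist2 (u s) Xstar ^+ 2)).
  by apply: measurable_funX; exact: (measurableT_comp (measurable_dist2 Xstar0) mu_).
set I := (\int[P]_s _)%E.
have I0 : (0 <= I)%E by apply: integral_ge0 => s _; rewrite lee_fin sqr_ge0.
have main z : Xstar z -> (I + L%:E <= (norm2 (x - z) ^+ 2)%:E)%E.
  move=> Xz; have [Xz' _] := Xz.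
  have mgr := measurable_growth a Xx Xz' mG.
  (* The growth term is nonnegative only almost everywhere; truncation makes it so everywhere, as
     additivity of nonnegative integrals requires. *)
  pose gr s := Num.max (growth F a x z (G s) s) 0.
  have mgr0 : measurable_fun setT gr by exact: measurable_maxr.
  have gr0 s : 0 <= gr s by rewrite le_max lexx orbT.
  have hae : {ae P, forall s, 0 <= growth F a x z (G s) s /\
      norm2 (u s - z) ^+ 2 + growth F a x z (G s) s <= norm2 (x - z) ^+ 2}.
    by apply: filterS (Xstar_min Xz) => s; exact: prox_step_decrease.
  have LE : (L%:E <= \int[P]_s (gr s)%:E)%E.
    apply: (le_trans (hL z G Xz _)).
      (* [G] selects subgradients of the model; the inclusion makes them subgradients of F, to which
         the growth bound applies. *)
      by split => // s; exact: hincl.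
    rewrite unlock le_eqVlt; apply/orP; left; apply/eqP; apply: ae_eq_integral => //.
    - exact/measurable_EFinP.
    - exact/measurable_EFinP.
    - by apply: filterS hae => s [h0 _] _; rewrite /gr (max_idPl h0).
  apply: (le_trans (leeD2l _ LE)).
  rewrite -ge0_integralD//; last 4 first.
  - by move=> s _; rewrite lee_fin sqr_ge0.
  - exact/measurable_EFinP.
  - by move=> s _; rewrite lee_fin.
  - exact/measurable_EFinP.
  apply: (@le_trans _ _ (\int[P]_s (cst (norm2 (x - z) ^+ 2)%:E s))%E).
    apply: ae_ge0_le_integral => //.
    - by move=> s _; rewrite -EFinD lee_fin addr_ge0// sqr_ge0.
    - by apply: emeasurable_funD; exact/measurable_EFinP.
    - by move=> s _; rewrite lee_fin sqr_ge0.
    apply: filterS hae => s [h0 h1] _.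
    rewrite -EFinD lee_fin /gr (max_idPl h0); apply: le_trans h1.
    by rewrite lerD2r sqr_dist2_le.
  by rewrite integral_cst// [X in (_ * X)%E](@probability_setT _ _ _ P) mule1.
have [z0 Xz0] := Xstar0.
have Ifin : I \is a fin_num.
  rewrite ge0_fin_numE//; have := main _ Xz0.
  by rewrite -leeBrDr// => /le_lt_trans; apply; rewrite -EFinB ltry.
move: main; rewrite -(fineK Ifin) => main.
by rewrite -EFinD lee_fin; apply: le_sqr_dist2 => // z /main.
Qed.

End OneStep.

(** * Integrals and null sets under the joint law of an independent pair *)

Section Joint.
Context {d1 d2 d3 : measure_display} {Omega : measurableType d1}
  {V : measurableType d2} {T : measurableType d3} {R : realType}
  (Pr : probability Omega R) (P : probability T R).
Variables (Y : Omega -> V) (Z : Omega -> T).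
Hypotheses (mY : measurable_fun setT Y) (mZ : measurable_fun setT Z).
Hypothesis YZ : forall B A, measurable B -> measurable A ->
  (Pr (Y @^-1` B `&` Z @^-1` A) = Pr (Y @^-1` B) * P A)%E.
Local Open Scope ereal_scope.

Lemma joint_integral (h : V * T -> \bar R) : measurable_fun setT h ->
  (forall p, 0 <= h p) ->
  \int[Pr]_w h (Y w, Z w) = \int[Pr]_w \int[P]_s h (Y w, s).
Proof.
move=> mh h0.
have mYZ : measurable_fun setT (fun w => (Y w, Z w)) by exact: measurable_fun_pair.
pose f : {mfun Omega >-> (V * T)%type} := mfun_Sub (mem_set mYZ).
pose g : {mfun Omega >-> V} := mfun_Sub (mem_set mY).
transitivity (\int[pushforward Pr f]_p h p).
  by rewrite (ge0_integral_pushforward mYZ).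
rewrite (eq_measure_integral (distribution Pr g \x P)); last first.
  by move=> C mC _; exact: joint_law.
rewrite fubini_tonelli1// (ge0_integral_pushforward mY)//.
  exact: measurable_fun_fubini_tonelli_F.
by move=> y _; apply: integral_ge0.
Qed.

Lemma joint_null (C : set (V * T)) : measurable C ->
  (forall y, P (xsection C y) = 0) ->
  Pr ((fun w => (Y w, Z w)) @^-1` C) = 0.
Proof.
move=> mC C0; rewrite (joint_law mY mZ YZ mC) /= /product_measure1.
by apply: integral0_eq => y _; exact: C0.
Qed.

End Joint.

Lemma measurable_prox_total {d : measure_display} {T : measurableType d}
    {R : realType} {n : nat} (X : set 'rV[R]_n) M (a : R) :
  closed X -> @measurable_prox d T R n X M a ->
  exists2 U : borel_rV R n * T -> borel_rV R n, measurable_fun setT U &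
    forall x s, X x -> prox_step X M a x s (U (x, s)).
Proof.
move=> cX [U mU pU].
have mX : measurable ((X : set (borel_rV R n)) `*` [set: T]).
  by apply: measurableX => //; exact: closed_measurable_rV.
(* Constant outside [X], hence measurable everywhere and composable with the iterates. *)
exists (U \_ ((X : set (borel_rV R n)) `*` [set: T])).
  exact/(measurable_restrictT _ mX).
by move=> x s Xx; rewrite patchE mem_set//=; exact: pU.
Qed.

(** * Rates *)

Section Rate.
Context {R : realType}.

(** Split D^2 as D^(1 - gam) D^(1 + gam). The bound by [l1] is then immediate, and the one by
    [l0 * a] uses that D^(1 - gam) is at most its initial value: here the monotonicity of the
    distance enters. *)
Lemma growth_rate_le (l0 l1 gam a D D1 : R) : 0 < l0 -> 0 < l1 -> 0 <= gam <= 1 ->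
  0 <= a -> 0 <= D <= D1 -> 0 < D1 ->
  Num.min l1 (l0 * a / D1 `^ (1 - gam)) * D ^+ 2 <=
  Num.min (l0 * a) (l1 * D `^ (1 - gam)) * D `^ (1 + gam).
Proof.
move=> l00 l10 /andP[g0 g1] a0 /andP[D0 DD1] D10.
have [->|Dn0] := eqVneq D 0.
  rewrite expr0n mulr0 mulr_ge0 ?powR_ge0//.
  by rewrite le_min !mulr_ge0 ?powR_ge0 ?(ltW l00) ?(ltW l10).
have -> : D ^+ 2 = D `^ (1 - gam) * D `^ (1 + gam).
  rewrite -powRD; last by rewrite Dn0 implybT.
  by rewrite -powR_mulrn//; congr (_ `^ _); ring.
rewrite mulrA ler_wpM2r ?powR_ge0// le_min; apply/andP; split.
  apply: (@le_trans _ _ (l0 * a / D1 `^ (1 - gam) * D `^ (1 - gam))).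
    by rewrite ler_wpM2r ?powR_ge0// ge_min lexx orbT.
  rewrite mulrAC ler_pdivrMr ?powR_gt0// ler_wpM2l ?mulr_ge0 ?(ltW l00)//.
  by rewrite ge0_ler_powR ?nnegrE// ?subr_ge0// ltW.
by rewrite ler_wpM2r ?powR_ge0// ge_min lexx.
Qed.

Lemma stepsize_gt0 (a beta : R) i : 0 < a -> (0 < i)%N -> 0 < stepsize a beta i.
Proof. by move=> a0 i0; rewrite mulr_gt0// powR_gt0// ltr0n. Qed.

Lemma threshold_ge0 (rho beta : R) : (0 <= threshold rho beta)%E.
Proof.
rewrite /threshold; case: ifP => _; first by do 2 case: ifP => // _.
by rewrite lee_fin ler0z floor_ge0 powR_ge0.
Qed.

(** The threshold is an integer or +oo. *)
Lemma threshold_ltS (rho beta : R) i :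
  (threshold rho beta < i.+1%:R%:E)%E -> (threshold rho beta <= i%:R%:E)%E.
Proof.
rewrite /threshold; case: ifP => _.
  case: ifP => _; first by rewrite lee_fin.
  by case: ifP => // _; rewrite lte_fin lee_fin ltr1n ler1n.
by rewrite lte_fin lee_fin !pmulrn !ltr_int ler_int -ltzD1 -addn1 PoszD.
Qed.

(** With [threshold_lt], this locates the change of sign of rho - i^beta. For nonzero [beta] the
    power 1 / beta is undone by the power [beta]; for [beta = 0] the power of [i] is 1 and the limit
    convention decides by comparing [rho] with 1. *)
Lemma le_threshold (rho beta : R) i : 0 < rho -> 0 <= beta -> (0 < i)%N ->
  (i%:R%:E <= threshold rho beta)%E -> i%:R `^ beta <= rho.
Proof.
move=> r0 b0 i0; rewrite /threshold; case: eqP => [->|/eqP bn0].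
  rewrite powRr0; case: ltP => // _.
  by rewrite lee_fin lern0 => /eqP i00; rewrite i00 in i0.
rewrite lee_fin pmulrn ler_int floor_ge_int => h.
have rhoE : rho = (rho `^ beta^-1) `^ beta.
  by rewrite -powRrM mulVf// powRr1// ltW.
by rewrite rhoE ge0_ler_powR// nnegrE// powR_ge0.
Qed.

Lemma threshold_lt (rho beta : R) i : 0 < rho -> 0 <= beta ->
  (threshold rho beta < i%:R%:E)%E -> rho <= i%:R `^ beta.
Proof.
move=> r0 b0; rewrite /threshold; case: eqP => [->|/eqP bn0].
  rewrite powRr0; case: (ltP rho 1) => [/ltW//|_].
  by case: eqP => [->//|_]; rewrite ltNge leey.
rewrite lte_fin pmulrn ltr_int floor_lt_int => h.
have rhoE : rho = (rho `^ beta^-1) `^ beta.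
  by rewrite -powRrM mulVf// powRr1// ltW.
by rewrite rhoE ge0_ler_powR// ?nnegrE ?powR_ge0// ltW.
Qed.

Lemma sum_rate_ge (l0 l1 q a0 beta : R) k : 0 < l0 -> 0 < l1 -> 0 < q -> 0 < a0 ->
  0 <= beta ->
  let K0 := threshold (l0 * a0 / (l1 * q)) beta in
  l1 * fine (Order.min k%:R%:E K0)
    + l0 / q * \sum_(1 <= i < k.+1 | (K0 < i%:R%:E)%E) stepsize a0 beta i
  <= \sum_(1 <= i < k.+1) Num.min l1 (l0 * stepsize a0 beta i / q).
Proof.
move=> l00 l10 q0 a00 b0; cbv zeta; set K0 := threshold _ _.
have r0 : 0 < l0 * a0 / (l1 * q) by rewrite divr_gt0// mulr_gt0.
rewrite big_mkcond/=; elim: k => [|k IH].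
  by rewrite !big_geq// mulr0 addr0 (min_idPl (threshold_ge0 _ _)) mulr0.
rewrite [X in _ + _ * X <= _]big_nat_recr// [leRHS]big_nat_recr//=.
have i0 : 0 < k.+1%:R `^ beta :> R by rewrite powR_gt0// ltr0n.
(* In this form, comparing the two entries of the minimum amounts to comparing rho with (k +
   1)^beta. *)
have aE : l0 * stepsize a0 beta k.+1 / q = l1 * (l0 * a0 / (l1 * q)) / k.+1%:R `^ beta.
  by rewrite /stepsize powRN; field; rewrite !lt0r_neq0.
case: (ltP K0 k.+1%:R%:E) => h.
  (* By integrality [K0] is at most [k], so the minimum with [K0] no longer grows and the new
     stepsize enters the sum. *)
  have hk := threshold_ltS h.
  rewrite (min_idPr hk) in IH.
  rewrite mulrDr addrA lerD// le_min; apply/andP; split.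
    rewrite mulrAC aE ler_pdivrMr// ler_pM2l//.
    exact: threshold_lt.
  by rewrite mulrAC.
have hk : (k%:R%:E <= K0)%E by apply: le_trans h; rewrite lee_fin ler_nat.
rewrite (min_idPl hk)/= in IH.
rewrite addr0 /= -natr1 mulrDr mulr1 addrAC lerD// le_min lexx/=.
rewrite aE ler_pdivlMr// ler_pM2l//.
exact: le_threshold.
Qed.

End Rate.

(** * The proximal iterates *)

Section Iterates.
Context {d d' : measure_display} {T : measurableType d}
  {Omega : measurableType d'} {R : realType} {n : nat}
  (P : probability T R) (X : set 'rV[R]_n)
  (F : 'rV[R]_n -> T -> \bar R) (M : 'rV[R]_n -> 'rV[R]_n -> T -> \bar R).
Hypothesis hXcl : closed X.
Hypothesis hXcv : convex_set X.
Hypothesis hFsub : forall s, subdifferentiable_on X (fun x => F x s).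
Hypothesis hf : objective_well_defined P X F.
Hypothesis hCi : cond_Ci X M.
Hypothesis hCii : cond_Cii X F M.
Hypothesis hCiii : cond_Ciii X F M.
Hypothesis hincl : subgradient_inclusion X F M.
Hypothesis hMsub : measurable_model_subgradient X M.
Variables (a : nat -> R) (Pr : probability Omega R) (S : nat -> Omega -> T).
Hypothesis a_gt0 : forall i, 0 < a i.
Hypothesis hMprox : forall i, measurable_prox X M (a i).
Hypothesis hS : iid_from Pr P S.
Variables (x : nat -> Omega -> 'rV[R]_n) (x0 : 'rV[R]_n).
Hypothesis Xx0 : X x0.
Hypothesis hinit : forall w, x 0%N w = x0.
Hypothesis hstep : forall i w, prox_step X M (a i) (x i w) (S i w) (x i.+1 w).

Lemma iterate_in i w : X (x i w).
Proof. by case: i => [|i]; [rewrite hinit|case: (hstep i w)]. Qed.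

(** The iterates are only assumed to lie in the argmin; uniqueness of the proximal point identifies
    them with the measurable update. *)
Lemma iterate_eq i U w : (forall y s, X y -> prox_step X M (a i) y s (U (y, s))) ->
  x i.+1 w = U (x i w, S i w).
Proof.
move=> pU; have Xi := iterate_in i w.
have [Mcv Msub] := hCi (S i w) Xi.
exact: prox_unique (a_gt0 i) hXcv Mcv Msub (hstep i w) (pU _ (S i w) Xi).
Qed.

Lemma iterate_measurable_indep i :
  measurable_fun setT (x i : Omega -> borel_rV R n) /\
  indep_of_future Pr S i (x i : Omega -> borel_rV R n).
Proof.
elim: i => [|i [mx ix]].
  rewrite (_ : x 0%N = cst x0); last exact/funext.
  by split; [exact: measurable_cst|exact: indep_of_future_cst].
have [U mU pU] := measurable_prox_total hXcl (hMprox i).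
rewrite (_ : x i.+1 = fun w => U (x i w, S i w)); last first.
  by apply/funext => w; exact: iterate_eq.
split; last exact: (indep_of_future_step hS mx mU ix).
apply: (measurableT_comp mU); apply: measurable_fun_pair => //.
exact: measurable_sample hS i.
Qed.

Let Xstar := solution_set P X F.
Hypothesis Xstar0 : Xstar !=set0.
Hypothesis Xstar_min : forall z, Xstar z -> ae_minimizer P X F z.

Lemma iterate_dist2_le_step i :
  {ae Pr, forall w, dist2 (x i.+1 w) Xstar <= dist2 (x i w) Xstar}.
Proof.
have [mx ix] := iterate_measurable_indep i.
have mS := measurable_sample hS i.
have [U mU pU] := measurable_prox_total hXcl (hMprox i).
have md := measurable_dist2 Xstar0.
(* The bad set of pairs (point, sample). Each section is null: at points of [X] by the one-step
   result, elsewhere because it is empty. Independence of [x i] and [S i] then makes the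
   corresponding event null. *)
pose C : set (borel_rV R n * T) :=
  ((X : set (borel_rV R n)) `*` setT) `&`
  ((fun p => dist2 (U p) Xstar - dist2 p.1 Xstar) @^-1` `]0, +oo[).
have mC : measurable C.
  apply: measurableI.
    by apply: measurableX => //; exact: closed_measurable_rV.
  rewrite -[X in measurable X]setTI.
  have : measurable_fun setT
    (fun p : borel_rV R n * T => dist2 (U p) Xstar - dist2 p.1 Xstar).
    apply: measurable_funB; first exact: (measurableT_comp md mU).
    exact: (measurableT_comp md measurable_fst).
  by apply.
have C0 y : P (xsection C y) = 0%E.
  apply/negligibleP; first exact: measurable_xsection.
  have [Xy|nXy] := pselect (X y); last first.
    rewrite (_ : xsection C y = set0); first exact: negligible_set0.
    by apply/seteqP; split => s // /xsectionP[[]].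
  have := prox_step_dist2_le hXcv hFsub hCi hCii hCiii hMsub Xstar0 Xstar_min
    (a_gt0 i) Xy (fun s => pU y s Xy).
  apply: negligibleS => s /xsectionP[_] /=.
  by rewrite in_itv/= andbT subr_gt0 => h; apply/negP; rewrite -ltNge.
have := joint_null mx mS (fun B A mB mA => indep_of_future_sample hS ix mB mA) mC C0.
move/negligibleP => h; apply: negligibleS (h _).
  move=> w /= /negP; rewrite -ltNge (iterate_eq _ pU) => hlt; split => /=.
    by split => //; exact: iterate_in.
  by rewrite in_itv/= andbT subr_gt0.
rewrite -[X in measurable X]setTI.
exact: (measurable_fun_pair mx mS measurableT mC).
Qed.

Lemma iterate_dist2_le i :
  {ae Pr, forall w, dist2 (x i w) Xstar <= dist2 x0 Xstar}.
Proof.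
elim: i => [|i IH]; first by apply: aeW => w; rewrite hinit.
by apply: filterS2 IH (iterate_dist2_le_step i) => w h1 h2; exact: le_trans h2 h1.
Qed.

Lemma measurable_dist2_iterate i :
  measurable_fun setT (fun w => dist2 (x i w) Xstar ^+ 2).
Proof.
have [mx _] := iterate_measurable_indep i.
by apply: measurable_funX; exact: (measurableT_comp (measurable_dist2 Xstar0) mx).
Qed.

Variables (l0 l1 gam : R).
Hypotheses (hl0 : 0 < l0) (hl1 : 0 < l1) (hgam : 0 <= gam <= 1).
Hypothesis hgrowth : growth_condition P X F l0 l1 gam.
Hypothesis D1_gt0 : 0 < dist2 x0 Xstar.

Definition contraction i := Num.min l1 (l0 * a i / dist2 x0 Xstar `^ (1 - gam)).

(** By independence and Tonelli the sample is integrated first, with the current iterate held fixed;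
    the one-step bound then applies to each iterate whose distance is at most the initial one, which
    is almost every one. *)
Lemma iterate_integral_step i :
  (\int[Pr]_w (dist2 (x i.+1 w) Xstar ^+ 2)%:E <=
   (expR (- contraction i))%:E * \int[Pr]_w (dist2 (x i w) Xstar ^+ 2)%:E)%E.
Proof.
have [mx ix] := iterate_measurable_indep i.
have mS := measurable_sample hS i.
have [U mU pU] := measurable_prox_total hXcl (hMprox i).
pose h (p : borel_rV R n * T) : \bar R := (dist2 (U p) Xstar ^+ 2)%:E.
have mh : measurable_fun setT h.
  apply/measurable_EFinP/measurable_funX.
  exact: (measurableT_comp (measurable_dist2 Xstar0) mU).
have h0 p : (0 <= h p)%E by rewrite lee_fin sqr_ge0.
have -> : (\int[Pr]_w (dist2 (x i.+1 w) Xstar ^+ 2)%:E =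
    \int[Pr]_w \int[P]_s h (x i w, s))%E.
  rewrite -(joint_integral mx mS (fun B A mB mA => indep_of_future_sample hS ix mB mA) mh h0).
  by apply: eq_integral => w _; rewrite /h (iterate_eq _ pU).
have mdi := measurable_dist2_iterate i.
rewrite -ge0_integralZl_EFin ?expR_ge0//; last 2 first.
- by move=> w _; rewrite lee_fin sqr_ge0.
- exact/measurable_EFinP.
apply: ae_ge0_le_integral => //.
- by move=> w _; apply: integral_ge0.
- exact: (measurableT_comp (measurable_fun_fubini_tonelli_F h mh h0) mx).
- by move=> w _; rewrite mule_ge0// lee_fin ?expR_ge0 ?sqr_ge0.
- by apply: measurable_funeM; exact/measurable_EFinP.
apply: filterS (iterate_dist2_le i) => w hw _.
have Xi := iterate_in i w.
have mUi : measurable_fun setT (fun s => U (x i w, s)).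
  by apply: (measurableT_comp mU); exact: measurable_pair1.
have := prox_step_integral hXcv hFsub hf hCi hCii hCiii hincl hMsub Xstar0 Xstar_min
  (a_gt0 i) Xi mUi (fun s => pU _ s Xi)
  (fun xs G Xxs hG => hgrowth (ltW (a_gt0 i)) Xi Xxs hG).
have := growth_rate_le hl0 hl1 hgam (ltW (a_gt0 i)) _ D1_gt0.
move=> /(_ (dist2 (x i w) Xstar)); rewrite dist2_ge0 hw => /(_ isT) hc.
rewrite -leeBrDr// => /le_trans; apply.
rewrite -EFinB -EFinM lee_fin.
have := expR_ge1Dx (- contraction i) => he.
apply: (@le_trans _ _ ((1 + - contraction i) * dist2 (x i w) Xstar ^+ 2)).
  by move: hc; rewrite -/(contraction i); lra.
by rewrite ler_wpM2r ?sqr_ge0.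
Qed.

Lemma iterate_integral i :
  (\int[Pr]_w (dist2 (x i w) Xstar ^+ 2)%:E <=
   (expR (- \sum_(j < i) contraction j) * dist2 x0 Xstar ^+ 2)%:E)%E.
Proof.
elim: i => [|i IH].
  rewrite big_ord0 oppr0 expR0 mul1r (eq_integral (cst (dist2 x0 Xstar ^+ 2)%:E)).
    by rewrite integral_cst// [X in (_ * X)%E](@probability_setT _ _ _ Pr) mule1.
  by move=> w _; rewrite hinit.
apply: (le_trans (iterate_integral_step i)).
rewrite big_ord_recr/= opprD addrC expRD -mulrA EFinM.
by rewrite lee_wpmul2l// lee_fin expR_ge0.
Qed.

End Iterates.

(** * The rate, with the degenerate cases *)

Theorem corollary4p1 (d d' : measure_display) (T : measurableType d)
    (Omega : measurableType d') (R : realType) (n : nat)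
    (P : probability T R) (X : set 'rV[R]_n)
    (F : 'rV[R]_n -> T -> \bar R)
    (hXcl : closed X) (hXcv : convex_set X)
    (hF : forall s, closed_convex (fun x => F x s))
    (hFsub : forall s, subdifferentiable_on X (fun x => F x s))
    (hf : objective_well_defined P X F)
    (hinterp : interpolation_problem P X F)
    (l0 l1 gam : R) (hl0 : 0 < l0) (hl1 : 0 < l1) (hgam : 0 <= gam <= 1)
    (hgrowth : growth_condition P X F l0 l1 gam)
    (M : 'rV[R]_n -> 'rV[R]_n -> T -> \bar R)
    (hCi : cond_Ci X M) (hCii : cond_Cii X F M) (hCiii : cond_Ciii X F M)
    (hincl : subgradient_inclusion X F M)
    (a0 beta : R) (ha0 : 0 < a0) (hbeta : 0 <= beta <= 1)
    (hMprox : forall k : nat, (0 < k)%N ->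
      measurable_prox X M (stepsize a0 beta k))
    (hMsub : measurable_model_subgradient X M)
    (Pr : probability Omega R) (S : nat -> Omega -> T)
    (hS : iid_from Pr P (fun i => S i.+1))
    (x1 : 'rV[R]_n) (hx1 : X x1) (x : nat -> Omega -> 'rV[R]_n)
    (hinit : forall w, x 1%N w = x1)
    (hstep : forall (k : nat) w, (0 < k)%N ->
      prox_step X M (stepsize a0 beta k) (x k w) (S k w) (x k.+1 w))
    (k : nat) (hk : (0 < k)%N) :
  let D1 := dist2 x1 (solution_set P X F) in
  let K0 := threshold (l0 * a0 / (l1 * D1 `^ (1 - gam))) beta in
  ('E_Pr[fun w => (dist2 (x k.+1 w) (solution_set P X F) ^+ 2)%R] <=
   (expR (- l1 * fine (Order.min (k%:R)%:E K0)
          - l0 / D1 `^ (1 - gam) *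
            \sum_(1 <= i < k.+1 | (K0 < (i%:R)%:E)%E) stepsize a0 beta i)
    * D1 ^+ 2)%R%:E)%E.
Proof.
cbv zeta; set Xstar := solution_set P X F; set D1 := dist2 x1 _.
set K0 := threshold _ _; rewrite unlock.
set r := (expR _ * _).
have r0 : 0 <= r by rewrite mulr_ge0 ?expR_ge0 ?sqr_ge0.
(* In the first case every point of [X] is a solution and the left-hand side is 0. *)
have [XXstar|Xstar_min] := solution_set_alt hFsub hf hinterp.
  rewrite integral0_eq// => w _; rewrite dist2_mem ?expr0n//.
  by apply: XXstar; case: (hstep k w hk).
have Xstar0 : Xstar !=set0 by case: hinterp => xs ? _; exists xs.
(* Shift from indices starting at 1 to indices starting at 0. *)
pose a i := stepsize a0 beta i.+1; pose y i := x i.+1.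
have a_gt0 i : 0 < a i by exact: stepsize_gt0.
have hprox i : measurable_prox X M (a i) by exact: hMprox.
have y0 : forall w, y 0%N w = x1 by [].
have yS i w : prox_step X M (a i) (y i w) (S i.+1 w) (y i.+1 w) by exact: hstep.
have D1_ge0 : 0 <= D1 by exact: dist2_ge0.
(* The contraction factor divides by a power of [D1]; for [D1 = 0], monotonicity alone keeps the
   distance at 0 almost surely. *)
have := D1_ge0; rewrite le_eqVlt => /predU1P[D10|D1_gt0].
  have hle := iterate_dist2_le hXcl hXcv hFsub hCi hCii hCiii hMsub a_gt0 hprox
    hS hx1 y0 yS Xstar0 Xstar_min k.
  have mdist := measurable_dist2_iterate hXcl hXcv hCi a_gt0 hprox hS hx1 y0 yS
    Xstar0 k.
  rewrite (@ae_eq_integral _ _ _ Pr setT (cst 0%E))//.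
  - by rewrite integral_cst// mul0e.
  - exact/measurable_EFinP.
  - apply: filterS hle => w; rewrite -/D1 -D10 => hw _.
    have -> : dist2 (x k.+1 w) Xstar = 0 by apply/eqP; rewrite eq_le hw dist2_ge0.
    by rewrite expr0n.
apply: (le_trans (iterate_integral hXcl hXcv hFsub hf hCi hCii hCiii hincl hMsub
  a_gt0 hprox hS hx1 y0 yS Xstar0 Xstar_min hl0 hl1 hgam hgrowth D1_gt0 k)).
rewrite lee_fin ler_wpM2r ?sqr_ge0// ler_expR mulNr -opprD lerN2.
have q0 : 0 < D1 `^ (1 - gam) by rewrite powR_gt0.
have [b0 _] := andP hbeta.
apply: (le_trans (sum_rate_ge k hl0 hl1 q0 ha0 b0)).
by rewrite big_add1 big_mkord.
Qed.
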